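(* Let $\mathfrak f$ be a free Lie algebra over $\mathbb Z$ with at least two free generators and let $\widehat{\mathfrak f}=\varprojlim_i \mathfrak f/\gamma_i(\mathfrak f)$ be its pronilpotent completion. Then $H_2(\widehat{\mathfrak f})$ is not a cotorsion group.
   Context: All Lie algebras are over $\mathbb Z$. For a Lie algebra $\mathfrak g$, the lower central series is $\gamma_1(\mathfrak g)=\mathfrak g$, $\gamma_{i+1}(\mathfrak g)=[\gamma_i(\mathfrak g),\mathfrak g]$, and $\widehat{\mathfrak g}=\varprojlim_i\mathfrak g/\gamma_i(\mathfrak g)$ (as an abstract Lie algebra). Homology is $H_n(\mathfrak g)=\mathrm{Tor}_n^{U\mathfrak g}(\mathbb Z,\mathbb Z)$, where $U\mathfrak g$ is the universal enveloping algebra; $H_2(\mathfrak g)$ is also naturally isomorphic to the homology at the middle term of $\Lambda^3\mathfrak g\to\Lambda^2\mathfrak g\to\mathfrak g$ with $d_2(a\wedge b)=[a,b]$ and $d_3(a\wedge b\wedge c)=[a,b]\wedge c+[b,c]\wedge a+[c,a]\wedge b$. An abelian group $A$ is called cotorsion if $\mathrm{Ext}^1_{\mathbb Z}(\mathbb Q,A)=0$. *)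

(* Defs.v *)
From HB Require Import structures.
From mathcomp Require Import all_boot ssralg ssrint rat.
From mathcomp Require Import generic_quotient ring_quotient.
From mathcomp Require Import boolp freeg.

Set Implicit Arguments.
Unset Strict Implicit.
Unset Printing Implicit Defensive.

Import GRing.Theory Quotient.Exports.
Local Open Scope ring_scope.
Local Open Scope quotient_scope.

(** * Abelian groups given by generators and relations *)

Inductive gen_subgroup (V : zmodType) (S : V -> Prop) : V -> Prop :=
| gen_mem x : S x -> gen_subgroup S x
| gen_zero : gen_subgroup S 0
| gen_sub x y : gen_subgroup S x -> gen_subgroup S y -> gen_subgroup S (x - y).

Definition zspan (V : zmodType) (S : V -> Prop) : {pred V} :=
  fun v => `[< gen_subgroup S v >].

Lemma zspanP (V : zmodType) (S : V -> Prop) v :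
  reflect (gen_subgroup S v) (v \in zspan S).
Proof. exact: asboolP. Qed.

Fact zspan_zmod_closed (V : zmodType) (S : V -> Prop) : zmod_closed (zspan S).
Proof.
split; first exact/zspanP/gen_zero.
by move=> x y /zspanP Sx /zspanP Sy; apply/zspanP/gen_sub.
Qed.
HB.instance Definition _ (V : zmodType) (S : V -> Prop) :=
  GRing.isZmodClosed.Build V (zspan S) (zspan_zmod_closed S).

(* [V / I], from the ring-quotient library: it only needs [I] to be a subgroup. *)
Local Notation quot := Quotient.quot.

Section Presentation.
Variables (K : choiceType) (S : {freeg K} -> Prop).

Definition presented := quot (zspan S).
HB.instance Definition _ := GRing.Zmodule.on presented.

Definition pgen (k : K) : presented := \pi_(quot (zspan S)) << k >>.

Variables (W : zmodType) (f : K -> W).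

(* [zmodule W] is [W] with its canonical structure of module over [int]. *)
Definition free_lift (D : {freeg K}) : W := fglift (f : K -> zmodule W) D.

Fact free_lift_is_zmod_morphism : zmod_morphism free_lift.
Proof. by move=> x y; exact: (@lift_is_additive int K (zmodule W) f x y). Qed.
HB.instance Definition _ :=
  GRing.isZmodMorphism.Build {freeg K} W free_lift free_lift_is_zmod_morphism.

Lemma free_liftU k : free_lift << k >> = f k.
Proof. by rewrite /free_lift liftU scale1r. Qed.

(* The map out of [presented] induced by [f]; it is meaningful only when [f]
   respects the relations, see [presented_liftE]. *)
Definition presented_lift (x : presented) : W :=
  free_lift (repr (x : quot (zspan S))).

Hypothesis Sf : forall D, S D -> free_lift D = 0.

Lemma free_lift_span D : D \in zspan S -> free_lift D = 0.
Proof.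
move=> /zspanP; elim=> {D} [D /Sf //||x y _ Hx _ Hy]; first exact: raddf0.
by rewrite raddfB /= Hx Hy subr0.
Qed.

Lemma presented_liftE D :
  presented_lift (\pi_(quot (zspan S)) D) = free_lift D.
Proof.
apply/eqP; rewrite -subr_eq0 /presented_lift -raddfB; apply/eqP.
by apply: free_lift_span; rewrite Quotient.idealrBE reprK.
Qed.

Lemma presented_lift_gen k : presented_lift (pgen k) = f k.
Proof. by rewrite presented_liftE free_liftU. Qed.

Lemma presented_lift_is_zmod_morphism : zmod_morphism presented_lift.
Proof.
move=> x y; rewrite -[x](@reprK _ (quot (zspan S))).
rewrite -[y](@reprK _ (quot (zspan S))).
set a := repr x; set b := repr y.
have -> : \pi_(quot (zspan S)) a - \pi_(quot (zspan S)) b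
          = \pi_(quot (zspan S)) (a - b) by rewrite !piE.
by rewrite !presented_liftE raddfB.
Qed.

Lemma presented_ind (P : presented -> Prop) :
  (forall k, P (pgen k)) -> P 0 -> (forall x y, P x -> P y -> P (x - y)) ->
  forall x, P x.
Proof.
move=> Pg P0 PB.
have PN x : P x -> P (- x) by move=> Px; rewrite -sub0r; apply: PB.
have PD x y : P x -> P y -> P (x + y).
  by move=> Px Py; rewrite -[y]opprK; apply/PB/PN.
move=> x; rewrite -[x](@reprK _ (quot (zspan S))).
rewrite -[repr x]freeg_sumE raddf_sum.
apply: (big_ind P) => // k _.
have -> : << coeff k (repr x) *g k >> = << k >> *~ coeff k (repr x).
  by rewrite freegU_mulz intz.
rewrite raddfMz; move: (coeff _ _) => n.
have Pn m : P (pgen k *+ m) by elim: m => // m IH; rewrite mulrS; apply: PD.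
by case: n => m /=; [apply: Pn | rewrite NegzE mulrNz; apply/PN/Pn].
Qed.

End Presentation.

(** * Lie algebras over the integers *)

HB.mixin Record Zmodule_isLie (L : Type) of GRing.Zmodule L := {
  lie : L -> L -> L;
  lieDl : forall x y z, lie (x + y) z = lie x z + lie y z;
  lieDr : forall x y z, lie x (y + z) = lie x y + lie x z;
  liexx : forall x, lie x x = 0;
  lie_jacobi : forall x y z,
    lie (lie x y) z + lie (lie y z) x + lie (lie z x) y = 0
}.

#[short(type="lieType")]
HB.structure Definition Lie := { L of GRing.Zmodule L & Zmodule_isLie L }.

Definition is_lie_morphism (L M : lieType) (h : L -> M) : Prop :=
  (forall x y, h (x + y) = h x + h y) /\
  (forall x y, h (lie x y) = lie (h x) (h y)).

(* [F] is the free Lie algebra on the family [i] of free generators. *)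
Definition is_free_lie (X : Type) (F : lieType) (i : X -> F) : Prop :=
  forall (L : lieType) (phi : X -> L),
    exists! h : F -> L, is_lie_morphism h /\ forall x, h (i x) = phi x.

Section LieTheory.
Variable L : lieType.
Implicit Types x y z : L.

Lemma lie0r x : lie 0 x = 0.
Proof. by apply: (addrI (lie 0 x)); rewrite -lieDl !addr0. Qed.
Lemma lier0 x : lie x 0 = 0.
Proof. by apply: (addrI (lie x 0)); rewrite -lieDr !addr0. Qed.
Lemma lieNl x y : lie (- x) y = - lie x y.
Proof. by apply: (addrI (lie x y)); rewrite -lieDl !subrr lie0r. Qed.
Lemma lieNr x y : lie x (- y) = - lie x y.
Proof. by apply: (addrI (lie x y)); rewrite -lieDr !subrr lier0. Qed.
Lemma lieBl x y z : lie (x - y) z = lie x z - lie y z.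
Proof. by rewrite lieDl lieNl. Qed.
Lemma lieBr x y z : lie x (y - z) = lie x y - lie x z.
Proof. by rewrite lieDr lieNr. Qed.
Lemma lie_antisym x y : lie x y = - lie y x.
Proof.
have := liexx (x + y); rewrite lieDl !lieDr !liexx add0r addr0 => /eqP.
by rewrite addr_eq0 => /eqP.
Qed.

End LieTheory.

(** * Lower central series and pronilpotent completion *)

(* Indices are shifted: [lcs L n] is the term usually written gamma_(n+1). *)
Fixpoint lcs (L : lieType) (n : nat) : {pred L} :=
  if n is m.+1 then
    zspan (fun v => exists a b : L, a \in lcs m /\ v = lie a b)
  else predT.
Arguments lcs : clear implicits.

Fact lcs_zmod_closed (L : lieType) n : zmod_closed (lcs L n).
Proof. by case: n => [|n]; [split | exact: zspan_zmod_closed]. Qed.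
HB.instance Definition _ (L : lieType) n :=
  GRing.isZmodClosed.Build L (lcs L n) (lcs_zmod_closed L n).

Section LowerCentralQuotient.
Variables (L : lieType).

Lemma lcs_lie n a b : a \in lcs L n -> lie a b \in lcs L n.+1.
Proof. by move=> La; apply/zspanP/gen_mem; exists a, b. Qed.

Lemma lcsS n a : a \in lcs L n.+1 -> a \in lcs L n.
Proof.
elim: n a => // n IHn a /zspanP.
elim=> {a} [_ [a [b [La ->]]]||x y _ Lx _ Ly]; first exact/lcs_lie/IHn.
  exact: rpred0.
exact: rpredB.
Qed.

Lemma lcs_ideal n a b : a \in lcs L n -> lie a b \in lcs L n.
Proof. by move=> /lcs_lie-/(_ b)/lcsS. Qed.

Lemma lcs_ideal_r n a b : b \in lcs L n -> lie a b \in lcs L n.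
Proof. by move=> Lb; rewrite lie_antisym rpredN lcs_ideal. Qed.

Section Fixn.
Variable n : nat.

Definition lcq := quot (lcs L n).
HB.instance Definition _ := GRing.Zmodule.on lcq.

Definition lcq_pi (x : L) : lcq := \pi_(quot (lcs L n)) x.

Fact lcq_pi_is_zmod_morphism : zmod_morphism lcq_pi.
Proof. by move=> x y; rewrite /lcq_pi !piE. Qed.
HB.instance Definition _ :=
  GRing.isZmodMorphism.Build L lcq lcq_pi lcq_pi_is_zmod_morphism.

Definition lcq_repr (x : lcq) : L := repr (x : quot (lcs L n)).

Lemma lcq_reprK x : lcq_pi (lcq_repr x) = x.
Proof. exact: reprK. Qed.

Lemma lcq_eqP x y : reflect (lcq_pi x = lcq_pi y) (x - y \in lcs L n).
Proof. by rewrite Quotient.idealrBE; apply: eqP. Qed.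

Definition lcq_lie (x y : lcq) : lcq := lcq_pi (lie (lcq_repr x) (lcq_repr y)).

Lemma lcq_lieE x y : lcq_lie (lcq_pi x) (lcq_pi y) = lcq_pi (lie x y).
Proof.
apply/lcq_eqP; set a := lcq_repr _; set b := lcq_repr _.
have La : a - x \in lcs L n by apply/lcq_eqP; rewrite lcq_reprK.
have Lb : b - y \in lcs L n by apply/lcq_eqP; rewrite lcq_reprK.
rewrite -[lie a b](subrK (lie x b)) -lieBl -addrA -lieBr.
by apply: rpredD; [exact: lcs_ideal | exact: lcs_ideal_r].
Qed.

Fact lcq_lieDl x y z : lcq_lie (x + y) z = lcq_lie x z + lcq_lie y z.
Proof.
rewrite -[x]lcq_reprK -[y]lcq_reprK -[z]lcq_reprK.
by rewrite -raddfD !lcq_lieE lieDl raddfD.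
Qed.
Fact lcq_lieDr x y z : lcq_lie x (y + z) = lcq_lie x y + lcq_lie x z.
Proof.
rewrite -[x]lcq_reprK -[y]lcq_reprK -[z]lcq_reprK.
by rewrite -raddfD !lcq_lieE lieDr raddfD.
Qed.
Fact lcq_liexx x : lcq_lie x x = 0.
Proof. by rewrite -[x]lcq_reprK lcq_lieE liexx raddf0. Qed.
Fact lcq_lie_jacobi x y z : lcq_lie (lcq_lie x y) z +
  lcq_lie (lcq_lie y z) x + lcq_lie (lcq_lie z x) y = 0.
Proof.
rewrite -[x]lcq_reprK -[y]lcq_reprK -[z]lcq_reprK !lcq_lieE.
by rewrite -!raddfD lie_jacobi raddf0.
Qed.
HB.instance Definition _ := Zmodule_isLie.Build lcq
  lcq_lieDl lcq_lieDr lcq_liexx lcq_lie_jacobi.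

Lemma lcq_pi_lie x y : lcq_pi (lie x y) = lie (lcq_pi x) (lcq_pi y).
Proof. exact: esym (lcq_lieE x y). Qed.

End Fixn.

(* The canonical projection L / gamma_(n+2) -> L / gamma_(n+1). *)
Definition lcq_proj n (x : lcq n.+1) : lcq n := lcq_pi n (lcq_repr x).

Lemma lcq_projE n x : lcq_proj (lcq_pi n.+1 x) = lcq_pi n x.
Proof. by apply/lcq_eqP/lcsS/lcq_eqP; rewrite lcq_reprK. Qed.

Fact lcq_proj_is_zmod_morphism n : zmod_morphism (@lcq_proj n).
Proof.
move=> x y; rewrite -[x]lcq_reprK -[y]lcq_reprK -raddfB !lcq_projE.
exact: raddfB.
Qed.
HB.instance Definition _ n := GRing.isZmodMorphism.Build (lcq n.+1) (lcq n)
  (@lcq_proj n) (@lcq_proj_is_zmod_morphism n).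

Lemma lcq_proj_lie n (x y : lcq n.+1) :
  lcq_proj (lie x y) = lie (lcq_proj x) (lcq_proj y).
Proof.
rewrite -[x]lcq_reprK -[y]lcq_reprK.
by rewrite -lcq_pi_lie !lcq_projE lcq_pi_lie.
Qed.

(* The inverse limit, as the Lie algebra of compatible sequences. *)
Record completion := Completion {
  cseq :> forall n, lcq n;
  cseq_compat : `[< forall n, lcq_proj (cseq n.+1) = cseq n >]
}.
HB.instance Definition _ := [isSub for cseq].
HB.instance Definition _ := [Choice of completion by <:].

Lemma cseqS (x : completion) n : lcq_proj (x n.+1) = x n.
Proof. by have /asboolP := cseq_compat x. Qed.

Lemma completionP (x y : completion) : (forall n, x n = y n) -> x = y.
Proof. by move=> xy; apply/val_inj/functional_extensionality_dep. Qed.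

Fact czero_subproof : `[< forall n, lcq_proj (0 : lcq n.+1) = 0 >].
Proof. by apply/asboolP => n; rewrite raddf0. Qed.
Definition czero := Completion czero_subproof.

Fact copp_subproof (x : completion) :
  `[< forall n, lcq_proj (- x n.+1) = - x n >].
Proof. by apply/asboolP => n; rewrite raddfN /= cseqS. Qed.
Definition copp x := Completion (copp_subproof x).

Fact cadd_subproof (x y : completion) :
  `[< forall n, lcq_proj (x n.+1 + y n.+1) = x n + y n >].
Proof. by apply/asboolP => n; rewrite raddfD /= !cseqS. Qed.
Definition cadd x y := Completion (cadd_subproof x y).

Fact clie_subproof (x y : completion) :
  `[< forall n, lcq_proj (lie (x n.+1) (y n.+1)) = lie (x n) (y n) >].
Proof. by apply/asboolP => n; rewrite lcq_proj_lie !cseqS. Qed.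
Definition clie x y := Completion (clie_subproof x y).

Fact caddA : associative cadd.
Proof. by move=> x y z; apply: completionP => n; apply: addrA. Qed.
Fact caddC : commutative cadd.
Proof. by move=> x y; apply: completionP => n; apply: addrC. Qed.
Fact cadd0 : left_id czero cadd.
Proof. by move=> x; apply: completionP => n; apply: add0r. Qed.
Fact caddN : left_inverse czero copp cadd.
Proof. by move=> x; apply: completionP => n; apply: addNr. Qed.
HB.instance Definition _ :=
  GRing.isZmodule.Build completion caddA caddC cadd0 caddN.

Fact clieDl (x y z : completion) : clie (x + y) z = clie x z + clie y z.
Proof. by apply: completionP => n; apply: lieDl. Qed.
Fact clieDr (x y z : completion) : clie x (y + z) = clie x y + clie x z.
Proof. by apply: completionP => n; apply: lieDr. Qed.
Fact cliexx (x : completion) : clie x x = 0.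
Proof. by apply: completionP => n; apply: liexx. Qed.
Fact clie_jacobi (x y z : completion) :
  clie (clie x y) z + clie (clie y z) x + clie (clie z x) y = 0.
Proof. by apply: completionP => n; apply: lie_jacobi. Qed.
HB.instance Definition _ := Zmodule_isLie.Build completion
  clieDl clieDr cliexx clie_jacobi.

End LowerCentralQuotient.

(** * Exterior powers of an abelian group *)

Section ExteriorPowers.
Variable V : zmodType.
Implicit Types a b c : V.

Inductive ext2_rel : {freeg (V * V)%type} -> Prop :=
| Ext2_addl a a' b : ext2_rel (<< (a + a', b) >> - << (a, b) >> - << (a', b) >>)
| Ext2_addr a b b' : ext2_rel (<< (a, b + b') >> - << (a, b) >> - << (a, b') >>)
| Ext2_alt a : ext2_rel << (a, a) >>.

Definition ext2 := presented ext2_rel.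
HB.instance Definition _ := GRing.Zmodule.on ext2.
Definition wedge2 a b : ext2 := pgen ext2_rel (a, b).

Inductive ext3_rel : {freeg (V * V * V)%type} -> Prop :=
| Ext3_add1 a a' b c : ext3_rel
    (<< (a + a', b, c) >> - << (a, b, c) >> - << (a', b, c) >>)
| Ext3_add2 a b b' c : ext3_rel
    (<< (a, b + b', c) >> - << (a, b, c) >> - << (a, b', c) >>)
| Ext3_add3 a b c c' : ext3_rel
    (<< (a, b, c + c') >> - << (a, b, c) >> - << (a, b, c') >>)
| Ext3_alt12 a c : ext3_rel << (a, a, c) >>
| Ext3_alt23 a b : ext3_rel << (a, b, b) >>
| Ext3_alt13 a b : ext3_rel << (a, b, a) >>.

Definition ext3 := presented ext3_rel.
HB.instance Definition _ := GRing.Zmodule.on ext3.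
Definition wedge3 a b c : ext3 := pgen ext3_rel (a, b, c).

Lemma ext2_rel0 D : ext2_rel D -> \pi_(quot (zspan ext2_rel)) D = 0.
Proof.
move=> SD; rewrite -[RHS](raddf0 (\pi_(quot (zspan ext2_rel)))).
by apply/eqP; rewrite -Quotient.idealrBE subr0; apply/zspanP/gen_mem.
Qed.

Lemma wedge2Dl a a' b : wedge2 (a + a') b = wedge2 a b + wedge2 a' b.
Proof.
have := ext2_rel0 (Ext2_addl a a' b); rewrite !raddfB /= -addrA -opprD.
by move=> /eqP; rewrite subr_eq0 => /eqP.
Qed.

Lemma wedge2Dr a b b' : wedge2 a (b + b') = wedge2 a b + wedge2 a b'.
Proof.
have := ext2_rel0 (Ext2_addr a b b'); rewrite !raddfB /= -addrA -opprD.
by move=> /eqP; rewrite subr_eq0 => /eqP.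
Qed.

Lemma wedge2xx a : wedge2 a a = 0.
Proof. exact: ext2_rel0 (Ext2_alt a). Qed.

Lemma wedge2_antisym a b : wedge2 a b = - wedge2 b a.
Proof.
have := wedge2xx (a + b); rewrite wedge2Dl !wedge2Dr !wedge2xx add0r addr0.
by move=> /eqP; rewrite addr_eq0 => /eqP.
Qed.

Lemma wedge20l a : wedge2 0 a = 0.
Proof. by apply: (addrI (wedge2 0 a)); rewrite -wedge2Dl !addr0. Qed.

Lemma wedge2Nl a b : wedge2 (- a) b = - wedge2 a b.
Proof. by apply: (addrI (wedge2 a b)); rewrite -wedge2Dl !subrr wedge20l. Qed.

End ExteriorPowers.

(** * Second homology of a Lie algebra *)

Section SecondHomology.
Variable L : lieType.
Implicit Types a b c : L.

Definition d2 : ext2 L -> L := presented_lift (fun p : L * L => lie p.1 p.2).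

Definition d3 : ext3 L -> ext2 L :=
  presented_lift (fun p : L * L * L => let: (a, b, c) := p in
    wedge2 (lie a b) c + wedge2 (lie b c) a + wedge2 (lie c a) b).

Fact d2_rel D : ext2_rel D -> free_lift (fun p : L * L => lie p.1 p.2) D = 0.
Proof.
case=> [a a' b|a b b'|a]; rewrite ?raddfB /= ?free_liftU /= ?liexx //.
  by rewrite lieDl addrAC addrK subrr.
by rewrite lieDr addrAC addrK subrr.
Qed.

Lemma d2E a b : d2 (wedge2 a b) = lie a b.
Proof. exact: presented_lift_gen d2_rel _. Qed.

HB.instance Definition _ := GRing.isZmodMorphism.Build (ext2 L) L d2
  (presented_lift_is_zmod_morphism d2_rel).

Fact d3_rel D : ext3_rel D ->
  free_lift (fun p : L * L * L => let: (a, b, c) := p in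
    wedge2 (lie a b) c + wedge2 (lie b c) a + wedge2 (lie c a) b) D = 0.
Proof.
have sub3 (x y z x' y' z' : ext2 L) :
    x + x' + (y + y') + (z + z') - (x + y + z) - (x' + y' + z') = 0.
  by apply/eqP; rewrite subr_eq0 subr_eq (addrACA x) (addrACA (x + y)) addrC.
case=> [a a' b c|a b b' c|a b c c'|a c|a b|a b];
  rewrite ?raddfB /= ?free_liftU /= ?lieDl ?lieDr ?wedge2Dl ?wedge2Dr ?sub3 //.
- by rewrite liexx wedge20l add0r (lie_antisym c a) wedge2Nl subrr.
- by rewrite liexx wedge20l addr0 (lie_antisym b a) wedge2Nl addrN.
- by rewrite liexx wedge20l addr0 (lie_antisym b a) wedge2Nl addrN.
Qed.

Lemma d3E a b c : d3 (wedge3 a b c) =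
  wedge2 (lie a b) c + wedge2 (lie b c) a + wedge2 (lie c a) b.
Proof. exact: presented_lift_gen d3_rel _. Qed.

HB.instance Definition _ := GRing.isZmodMorphism.Build (ext3 L) (ext2 L) d3
  (presented_lift_is_zmod_morphism d3_rel).

Lemma d2_d3 t : d2 (d3 t) = 0.
Proof.
elim/presented_ind: t => [[[a b] c]||x y Hx Hy].
- by rewrite -/(wedge3 a b c) d3E !raddfD /= !d2E lie_jacobi.
- by rewrite !raddf0.
- by rewrite !raddfB /= Hx Hy subr0.
Qed.

Definition cycle2 : {pred ext2 L} := [pred z | d2 z == 0].

Fact cycle2_zmod_closed : zmod_closed cycle2.
Proof.
split=> [|x y]; rewrite !inE ?raddf0 // => /eqP Hx /eqP Hy.
by rewrite raddfB /= Hx Hy subr0.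
Qed.
HB.instance Definition _ :=
  GRing.isZmodClosed.Build (ext2 L) cycle2 cycle2_zmod_closed.

Record Z2 := MkZ2 { Z2val :> ext2 L; Z2valP : Z2val \in cycle2 }.
HB.instance Definition _ := [isSub for Z2val].
HB.instance Definition _ := [Choice of Z2 by <:].
HB.instance Definition _ := [SubChoice_isSubZmodule of Z2 by <:].

Definition boundary2 : {pred Z2} :=
  fun z => `[< exists t : ext3 L, d3 t = val z >].

Fact boundary2_zmod_closed : zmod_closed boundary2.
Proof.
split=> [|x y /asboolP[s Hs] /asboolP[t Ht]]; apply/asboolP.
  by exists 0; rewrite !raddf0.
by exists (s - t); rewrite !raddfB /= Hs Ht.
Qed.
HB.instance Definition _ :=
  GRing.isZmodClosed.Build Z2 boundary2 boundary2_zmod_closed.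

(* Homology at the middle term of [ext3 L -> ext2 L -> L]; this is the model
   of Tor_2^(UL)(Z, Z) used here. *)
Definition H2 := quot boundary2.
HB.instance Definition _ := GRing.Zmodule.on H2.

End SecondHomology.

(** * Extensions of abelian groups and cotorsion groups *)

(* Short exact sequences 0 -> A -> E -> C -> 0, representing the elements of
   the Yoneda group Ext^1(C, A). *)
Record extension (C A : zmodType) := Extension {
  ext_mid : zmodType;
  ext_inj : {additive A -> ext_mid};
  ext_proj : {additive ext_mid -> C};
  ext_inj_injective : injective ext_inj;
  ext_exact : forall e, ext_proj e = 0 <-> exists a, ext_inj a = e;
  ext_proj_surjective : forall c, exists e, ext_proj e = c
}.

(* By the five lemma such an [h] is an isomorphism. *)
Definition ext_equiv (C A : zmodType) (E E' : extension C A) : Prop :=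
  exists h : {additive ext_mid E -> ext_mid E'},
    (forall a, h (ext_inj E a) = ext_inj E' a) /\
    (forall e, ext_proj E' (h e) = ext_proj E e).

Section TrivialExtension.
Variables C A : zmodType.

Definition triv_inj (a : A) : (A * C)%type := (a, 0).
Fact triv_inj_is_zmod_morphism : zmod_morphism triv_inj.
Proof. by move=> x y; congr pair; rewrite subr0. Qed.
HB.instance Definition _ := GRing.isZmodMorphism.Build A (A * C)%type
  triv_inj triv_inj_is_zmod_morphism.

Fact triv_inj_injective : injective triv_inj.
Proof. by move=> x y []. Qed.
Fact triv_exact (e : A * C) : e.2 = 0 <-> exists a, triv_inj a = e.
Proof. by split=> [|[a <-] //]; case: e => a c /= ->; exists a. Qed.
Fact triv_proj_surjective (c : C) : exists e : A * C, e.2 = c.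
Proof. by exists (0, c). Qed.

Definition trivial_extension : extension C A :=
  @Extension C A (A * C)%type triv_inj (@snd A C : {additive _ -> _})
    triv_inj_injective triv_exact triv_proj_surjective.

End TrivialExtension.

(* Every class is that of the split extension, the zero of Ext^1(C, A). *)
Definition Ext1_eq0 (C A : zmodType) : Prop :=
  forall E : extension C A, ext_equiv E (trivial_extension C A).

Definition cotorsion (A : zmodType) : Prop := Ext1_eq0 rat A.

(* Main.v *)
From HB Require Import structures.
Require Import Defs.
From mathcomp Require Import all_boot all_order all_algebra.
From mathcomp Require Import generic_quotient ring_quotient.
From mathcomp Require Import boolp classical_sets functions freeg.
From mathcomp Require Import ring zify.

Set Implicit Arguments.
Unset Strict Implicit.
Unset Printing Implicit Defensive.

Import Order.TTheory GRing.Theory Num.Theory Quotient.Exports.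
Local Open Scope ring_scope.
Local Open Scope quotient_scope.

(** In a cotorsion group one can prescribe an element modulo every prime at
    once.  Let [x], [y] be two of the free generators, and let the generator
    [x] act on [F_p[[X]]] as multiplication by [X]; sending [y] to [1] maps the
    completion to [F_p |x F_p[[X]]].  For power series [a], [b] over the
    integers, the bracket of [alpha = a(ad x) y] and [beta = b(ad x) y] has the
    form [[x, g] + [y, e]], so that [alpha /\ beta - x /\ g - y /\ e] is a cycle.
    If [psi], [psi'] are additive maps from [F_p[[X]]] to [F_p(X)] which kill
    [1], the first [X]-linear and the second linear with respect to [X |-> -X],
    then [psi(a) psi'(b) - psi(b) psi'(a)] is well defined on homology modulo
    [p].  Taking for [a], [b] lacunary series, which together with [1] are
    linearly independent over [F_p(X)], one gets cycles [tau k] and dual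
    functionals for which the matrix of [sum_(k < p) tau k] has rank [p], whereas
    a homology class represented by [r] wedges has rank at most [2 r].  Hence no
    class is congruent to [sum_(k < p) tau k] modulo [p] for every prime [p]. *)

(** * Cotorsion groups *)

Section PolyLin.
Variables (A : zmodType) (a : nat -> A).

(** [{poly int}] serves as the free abelian group on the monomials, and this is the additive map out
    of it with values [a n] on the basis. *)
Definition poly_lin (q : {poly int}) : A := \sum_(n < size q) a n *~ q`_n.

Lemma poly_lin_wide N (q : {poly int}) : (size q <= N)%N ->
  poly_lin q = \sum_(n < N) a n *~ q`_n.
Proof.
move=> leqN; rewrite /poly_lin (big_ord_widen _ (fun n => a n *~ q`_n) leqN).
rewrite big_mkcond; apply: eq_bigr => n _; case: ltnP => // /(nth_default 0) ->.
by rewrite mulr0z.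
Qed.

Fact poly_lin_is_zmod_morphism : zmod_morphism poly_lin.
Proof.
move=> p q; set N := maxn (size p) (size q).
rewrite (@poly_lin_wide N p) ?leq_maxl // (@poly_lin_wide N q) ?leq_maxr //.
rewrite (@poly_lin_wide N); last first.
  by rewrite (leq_trans (size_polyD _ _)) ?size_polyN.
by rewrite -sumrB; apply: eq_bigr => n _; rewrite coefB mulrzBr.
Qed.
HB.instance Definition _ :=
  GRing.isZmodMorphism.Build {poly int} A poly_lin poly_lin_is_zmod_morphism.

Lemma poly_linXn n : poly_lin 'X^n = a n.
Proof.
rewrite (@poly_lin_wide n.+1) ?size_polyXn // big_ord_recr /= coefXn eqxx.
rewrite big1 ?add0r // => i _; rewrite coefXn; case: eqVneq => // E.
by have := ltn_ord i; rewrite E ltnn.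
Qed.

End PolyLin.

(* Maps [X^n] to [X^n - (n+1) X^(n+1)], so that the cokernel is the group of
   rational numbers with [X^n] standing for [1/n!]. *)
Definition fact_rel (q : {poly int}) : {poly int} := q - (q * 'X)^`() * 'X.

Fact fact_rel_is_zmod_morphism : zmod_morphism fact_rel.
Proof. by move=> p q; rewrite /fact_rel mulrBl derivB mulrBl; ring. Qed.
HB.instance Definition _ := GRing.isZmodMorphism.Build {poly int} {poly int}
  fact_rel fact_rel_is_zmod_morphism.

Lemma coef_fact_rel0 q : (fact_rel q)`_0 = q`_0.
Proof. by rewrite coefB coefMX subr0. Qed.

Lemma coef_fact_relS q n : (fact_rel q)`_n.+1 = q`_n.+1 - q`_n *+ n.+1.
Proof. by rewrite coefB coefMX coef_deriv coefMX. Qed.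

Lemma fact_relXn n : fact_rel 'X^n = 'X^n - ('X^(n.+1) *+ n.+1).
Proof. by rewrite /fact_rel -exprSr derivXn /= mulrnAl -exprSr. Qed.

Lemma fact_rel_inj q : fact_rel q = 0 -> q = 0.
Proof.
move=> q0; apply/polyP; elim=> [|n IHn].
  by rewrite -coef_fact_rel0 q0.
have := coef_fact_relS q n; rewrite q0 IHn !coef0 mul0rn subr0.
by move=> <-.
Qed.

Definition inv_fact (n : nat) : rat := (n`!)%:R^-1.

Lemma inv_fact_neq0 n : inv_fact n != 0.
Proof. by rewrite invr_eq0 pnatr_eq0 -lt0n fact_gt0. Qed.

Lemma inv_factS n : inv_fact n.+1 *+ n.+1 = inv_fact n.
Proof.
by rewrite /inv_fact factS natrM invfM -[LHS]mulr_natr mulrAC mulVf ?mul1r ?pnatr_eq0.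
Qed.

(** The sum telescopes by [inv_factS]. Once [N] passes the degree of [r] the right-hand side is
    zero. *)
Lemma fact_rel_psum r N :
  \sum_(n < N.+1) inv_fact n *~ (fact_rel r)`_n = inv_fact N *~ r`_N.
Proof.
elim: N => [|N IHN]; first by rewrite big_ord1 coef_fact_rel0.
rewrite big_ord_recr /= {}IHN coef_fact_relS mulrzBr -[_ *+ N.+1]mulr_natl mulrzA.
by rewrite natz -pmulrn inv_factS addrCA subrr addr0.
Qed.

Lemma fact_rel_ker q :
  poly_lin inv_fact q = 0 <-> exists r, fact_rel r = q.
Proof.
split=> [q0|[r <-]]; last first.
  set N := maxn (size r) (size (fact_rel r)).
  rewrite (@poly_lin_wide _ _ N.+1) ?leqW ?leq_maxr // fact_rel_psum.
  by rewrite nth_default ?mulr0z ?leq_maxl.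
(* This recursion is forced on a preimage of [q] by [coef_fact_relS]. Since [rec N] is [N!] times
   the [N]-th partial sum, on the kernel it vanishes once all of [q] is summed, so the preimage is a
   polynomial. *)
pose fix rec n : int := if n is m.+1 then q`_n + rec m *+ n else q`_0.
have rec_psum N : \sum_(n < N.+1) inv_fact n *~ q`_n = inv_fact N *~ rec N.
  elim: N => [|N IHN]; first by rewrite big_ord1.
  rewrite big_ord_recr /= {}IHN mulrzDr -[_ *+ N.+1]mulr_natl mulrzA addrC.
  by rewrite natz -pmulrn inv_factS.
exists (\poly_(n < size q) rec n); apply/polyP => -[|n].
  rewrite coef_fact_rel0 coef_poly; case: ltnP => // le0.
  by rewrite nth_default.
rewrite coef_fact_relS !coef_poly.
case: (ltnP n.+1 (size q)) => [lt_n|le_n].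
  by rewrite (ltnW lt_n) /= addrK.
rewrite (nth_default _ le_n); case: ltnP => [lt_n|]; last by rewrite mul0rn subr0.
have := rec_psum n; rewrite -(poly_lin_wide _ le_n) q0 => /esym/eqP.
rewrite -mulrzr mulf_eq0 (negPf (inv_fact_neq0 n)) intr_eq0 /= => /eqP ->.
by rewrite mul0rn subr0.
Qed.

Section FactorialExtension.
Variables (A : zmodType) (a : nat -> A).

(** Pushout of the resolution [fact_rel] of the rationals along [poly_lin a]: dividing by these
    pairs identifies [fact_rel 'X^n] with [a n]. *)
Definition ext_rel : {pred A * {poly int}} :=
  fun e => `[< exists q, e = (- poly_lin a q, fact_rel q) >].

Fact ext_rel_zmod_closed : zmod_closed ext_rel.
Proof.
split=> [|_ _ /asboolP[p ->] /asboolP[q ->]]; apply/asboolP.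
  by exists 0; rewrite !raddf0 ?oppr0.
by exists (p - q); rewrite (raddfB (poly_lin a)) (raddfB fact_rel) opprD.
Qed.
HB.instance Definition _ :=
  GRing.isZmodClosed.Build (A * {poly int})%type ext_rel ext_rel_zmod_closed.

Definition fact_mid := Quotient.quot ext_rel.
HB.instance Definition _ := GRing.Zmodule.on fact_mid.

Definition fact_pi (e : A * {poly int}) : fact_mid := \pi_(Quotient.quot ext_rel) e.
Fact fact_pi_is_zmod_morphism : zmod_morphism fact_pi.
Proof. by move=> x y; rewrite /fact_pi !piE. Qed.
HB.instance Definition _ := GRing.isZmodMorphism.Build (A * {poly int})%type
  fact_mid fact_pi fact_pi_is_zmod_morphism.

Lemma fact_pi_eqP x y : fact_pi x = fact_pi y <-> x - y \in ext_rel.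
Proof. by rewrite Quotient.idealrBE; split => [/eqP|/eqP]. Qed.

Lemma fact_pi_surj x : exists e, fact_pi e = x.
Proof. by exists (repr (x : Quotient.quot ext_rel)); apply: reprK. Qed.

Definition fact_inj (b : A) : fact_mid := fact_pi (b, 0).
Fact fact_inj_is_zmod_morphism : zmod_morphism fact_inj.
Proof.
by move=> x y; rewrite /fact_inj -raddfB; congr fact_pi; congr pair; rewrite subr0.
Qed.
HB.instance Definition _ := GRing.isZmodMorphism.Build A
  fact_mid fact_inj fact_inj_is_zmod_morphism.

Definition fact_proj (x : fact_mid) : rat :=
  poly_lin inv_fact (repr (x : Quotient.quot ext_rel)).2.

Lemma fact_projE e : fact_proj (fact_pi e) = poly_lin inv_fact e.2.
Proof.
rewrite /fact_proj; set e' := repr _.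
have /fact_pi_eqP/asboolP[q] : fact_pi e' = fact_pi e by apply: reprK.
move=> /(congr1 snd) /= E; apply/eqP; rewrite -subr_eq0 -raddfB E.
by apply/eqP/fact_rel_ker; exists q.
Qed.

Fact fact_proj_is_zmod_morphism : zmod_morphism fact_proj.
Proof.
move=> x y; have [d <-] := fact_pi_surj x; have [e <-] := fact_pi_surj y.
by rewrite -raddfB !fact_projE raddfB.
Qed.
HB.instance Definition _ := GRing.isZmodMorphism.Build
  fact_mid rat fact_proj fact_proj_is_zmod_morphism.

Fact fact_inj_injective : injective fact_inj.
Proof.
move=> x y /fact_pi_eqP/asboolP[q] [Exy]; rewrite subr0 => /esym/fact_rel_inj q0.
by apply/eqP; rewrite -subr_eq0 Exy q0 raddf0 oppr0.
Qed.

Fact fact_exact x : fact_proj x = 0 <-> exists b, fact_inj b = x.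
Proof.
have [[b q] <-] := fact_pi_surj x; rewrite fact_projE; split=> [/fact_rel_ker[r Er]|].
  exists (b + poly_lin a r); apply/fact_pi_eqP/asboolP; exists (- r).
  rewrite !raddfN /= opprK Er; congr pair; last exact: sub0r.
  by rewrite /= addrAC subrr add0r.
move=> [c /fact_pi_eqP/asboolP[r /(congr1 snd)/=]]; rewrite sub0r => Eq.
by apply/fact_rel_ker; exists (- r); rewrite raddfN /= -Eq opprK.
Qed.

Fact fact_proj_surjective c : exists x, fact_proj x = c.
Proof.
have den_gt0 : (0 < `|denq c|)%N by rewrite absz_gt0 denq_neq0.
set d := `|denq c|%N in den_gt0 *.
(* With [d] the denominator, [(d - 1)! / d!] is [1 / d]. *)
exists (fact_pi (0, ('X^d *+ (d.-1)`!) *~ numq c)).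
rewrite fact_projE raddfMz raddfMn /= poly_linXn /inv_fact.
rewrite -[in RHS](divq_num_den c) -mulrzl; congr (_ * _).
rewrite -[d in d`!]prednK // factS prednK // natrM invfM -mulrnAr.
rewrite -[_ *+ (d.-1)`!]mulr_natr mulVf ?mulr1; last first.
  by rewrite pnatr_eq0 -lt0n fact_gt0.
by rewrite -[d%:R]/(d%:Z%:~R) absz_denq.
Qed.

Definition fact_extension : extension rat A :=
  @Extension rat A fact_mid fact_inj fact_proj
    fact_inj_injective fact_exact fact_proj_surjective.

(** The [A]-component of a splitting of [fact_extension] is the identity on [A]; its values on the
    classes of ['X^n] solve the system. *)
Lemma cotorsion_fact_solution (cA : cotorsion A) :
  exists x : nat -> A, forall n, x n = a n + x n.+1 *+ n.+1.
Proof.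
have [h [hi _]] := cA fact_extension; pose t n := h (fact_pi (0, 'X^n)).
exists (fun n => (t n).1) => n.
suff -> : t n = triv_inj rat (a n) + t n.+1 *+ n.+1.
  by rewrite (raddfD (@fst A rat)) (raddfMn (@fst A rat)).
rewrite -[triv_inj _ _](hi (a n)) /t -raddfMn -raddfD; congr (h _).
rewrite /= /fact_inj -raddfMn -raddfD; apply/fact_pi_eqP/asboolP.
exists 'X^n; rewrite poly_linXn fact_relXn; congr pair => /=.
  by rewrite (raddfMn (@fst A {poly int})) /= mul0rn addr0 sub0r.
by rewrite (raddfMn (@snd A {poly int})) /= add0r.
Qed.

End FactorialExtension.

(* Prescribing [x] modulo every prime at once is solvable in a cotorsion group:
   by Wilson the coefficient [(p-1)!] of the system above is [-1] modulo [p],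
   and the later ones vanish modulo [p]. *)
Lemma cotorsion_simultaneous_congruence (A : zmodType) (t : nat -> A) :
  cotorsion A ->
  exists x, forall p, prime p -> exists y, x = t p + y *+ p.
Proof.
move=> cA.
(* [S n] collects the first [n] steps of the system whose [n]-th right-hand side is the current
   error [S n - t n.+1]. When [n.+1] is prime, adding this error [n!] times removes it modulo
   [n.+1]. *)
pose fix S n : A := if n is m.+1 then S m + (S m - t n) *+ m`! else 0.
have [x xE] := cotorsion_fact_solution (fun n => S n - t n.+1) cA.
have x0E n : x 0%N = S n + x n *+ n`!.
  elim: n => [|n IHn]; first by rewrite add0r.
  by rewrite IHn xE /= mulrnDl -mulrnA -factS addrA.
exists (x 0%N) => -[|m] // p_pr.
have := p_pr; rewrite Wilson ?prime_gt1 //= => /dvdnP[k Ek].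
exists ((S m - t m.+1) *+ k + x m.+1 *+ m`!).
set d := S m - t m.+1.
have -> : x 0%N = S m + d *+ m`! + x m.+1 *+ (m.+1)`! := x0E m.+1.
have -> : S m = t m.+1 + d by rewrite addrC subrK.
clearbody d; rewrite factS mulnC mulrnA mulrnDl addrA -(mulrnA d) -Ek.
by rewrite (mulrS d) !addrA.
Qed.

(** * Semilinear functionals and power series *)

Section FunctionalExtension.
Variables (R : comNzRingType) (V : lmodType R) (K : fieldType).
Variable rho : {rmorphism R -> K}.
Hypothesis rho_inj : forall r, rho r = 0 -> r = 0.

(** Partial semilinear maps are given by their graphs, so that Zorn's lemma applies to sets ordered
    by inclusion; the last clause is single-valuedness. *)
Definition semilinear_graph (G : set (V * K)) : Prop :=
  [/\ forall x y, G x -> G y -> G (x.1 - y.1, x.2 - y.2),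
      forall r x, G x -> G (r *: x.1, rho r * x.2)
    & forall k, G (0, k) -> k = 0].

(** The value at [v] is forced to be [k / rho r] when a nonzero multiple [r *: v] already has the
    value [k], and may be taken to be 0 otherwise. The division is possible since [rho] is injective
    into a field. *)
Lemma semilinear_graph_step G v : semilinear_graph G -> G (0, 0) ->
  exists B, [/\ subset G B, semilinear_graph B & exists k, B (v, k)].
Proof.
move=> [GB GZ G0] G00.
have [k0 k0P] : exists k0, forall h r, G h -> h.1 + r *: v = 0 ->
    h.2 + rho r * k0 = 0.
  have [[r0 [k [r0_neq0 Gk]]]|noG] :=
      pselect (exists r k, r != 0 /\ G (r *: v, k)).
    have rho0 : rho r0 != 0 by apply: contraNneq r0_neq0 => /rho_inj ->.
    exists (k / rho r0) => h r Gh hv.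
    have := GB _ _ (GZ r0 _ Gh) (GZ (- r) _ Gk); rewrite /= rmorphN.
    rewrite scaleNr opprK scalerA mulrC -scalerA -scalerDr hv scaler0.
    move=> /G0 E; apply: (mulfI rho0); rewrite mulr0 -[RHS]E.
    by field.
  exists 0 => -[u k] r Gh /= uv; have [r0|r_neq0] := eqVneq r 0.
    move: uv Gh; rewrite r0 scale0r addr0 mulr0 addr0 => ->; exact: G0.
  case: noG; exists r, (- k); split => //.
  have := GB _ _ G00 Gh; rewrite /= !sub0r.
  by move: uv => /eqP; rewrite addrC addr_eq0 => /eqP ->.
exists ([set z : V * K |
    exists h r, G h /\ z = (h.1 + r *: v, h.2 + rho r * k0)]%classic); split.
- move=> [u k] Gu; exists (u, k), 0; split => //=.
  by rewrite scale0r rmorph0 mul0r !addr0.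
- split.
  + move=> _ _ [h [r [Gh ->]]] [h' [r' [Gh' ->]]].
    exists (h.1 - h'.1, h.2 - h'.2), (r - r'); split; first exact: GB.
    rewrite /= scalerBl rmorphB mulrBl !opprD !addrA.
    by rewrite -!addrA ![_ + (- _ - _)]addrCA.
  + move=> s _ [h [r [Gh ->]]].
    exists (s *: h.1, rho s * h.2), (s * r); split; first exact: GZ.
    by rewrite /= scalerDr scalerA rmorphM mulrDr mulrA.
  + move=> k [h [r [Gh [/esym hv ->]]]]; exact: k0P hv.
- exists k0, (0, 0), 1; split => //=.
  by rewrite scale1r rmorph1 mul1r !add0r.
Qed.

Lemma semilinear_extension G : semilinear_graph G -> G (0, 0) ->
  exists psi : V -> K,
    [/\ forall u v, psi (u - v) = psi u - psi v,
        forall r v, psi (r *: v) = rho r * psi v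
      & forall v k, G (v, k) -> psi v = k].
Proof.
move=> sG G00.
(* The condition is put on the union with [G], so that the empty chain satisfies it too. *)
have [|A [sA Amax]] := @Zorn_bigcup (V * K)%type
    (fun A => semilinear_graph (G `|` A)%classic).
  move=> F FP Ftot.
  (* Each clause involves at most two elements of the graph, and along a chain any two lie in a
     common member. *)
  have two x y : (G `|` \bigcup_(X in F) X)%classic x ->
      (G `|` \bigcup_(X in F) X)%classic y ->
      exists Y, [/\ semilinear_graph Y, subset Y (G `|` \bigcup_(X in F) X)%classic,
                    Y x & Y y].
    have FGX X : F X -> subset (G `|` X)%classic (G `|` \bigcup_(X in F) X)%classic.
      by move=> FX z [?|Xz]; [left | right; exists X].
    move=> [Gx|[X FX Xx]] [Gy|[Y FY Yy]].
    - by exists G; split => // z; left.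
    - by exists (G `|` Y)%classic; split; [exact: FP | exact: FGX | left | right].
    - by exists (G `|` X)%classic; split; [exact: FP | exact: FGX | right | left].
    - have [XY|YX] := Ftot _ _ FX FY.
        exists (G `|` Y)%classic; split; [exact: FP|exact: FGX|right; exact: XY|by right].
      exists (G `|` X)%classic; split; [exact: FP|exact: FGX|by right|right; exact: YX].
  split.
  - by move=> x y Ux Uy; have [Y [[YB _ _] sY Yx Yy]] := two x y Ux Uy; apply/sY/YB.
  - by move=> r x Ux; have [Y [[_ YZ _] sY Yx _]] := two x x Ux Ux; apply/sY/YZ.
  - by move=> k Ux; have [Y [[_ _ Y0] sY Yx _]] := two _ _ Ux Ux; apply: Y0.
set H := (G `|` A)%classic in sA *.
have H00 : H (0, 0) by left.
have Htot v : exists k, H (v, k).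
  have [B [HB sB [k Bk]]] := semilinear_graph_step v sA H00.
  apply: contrapT => noH; apply: (Amax B).
    split=> [z Az|BA]; first by apply: HB; right.
    by apply: noH; exists k; right; apply: BA.
  have -> // : (G `|` B)%classic = B.
  by apply/seteqP; split => z; [case=> // Gz; apply: HB; left | right].
have [HB HZ H0] := sA.
have Hfun v k k' : H (v, k) -> H (v, k') -> k = k'.
  move=> Hk Hk'; have := HB _ _ Hk Hk'; rewrite /= subrr => /H0/eqP.
  by rewrite subr_eq0 => /eqP.
pose psi v := projT1 (cid (Htot v)).
have psiP v : H (v, psi v) := projT2 (cid (Htot v)).
exists psi; split=> [u v|r v|v k Gk].
- by apply: Hfun (psiP _) _; exact: (HB _ _ (psiP u) (psiP v)).
- by apply: Hfun (psiP _) _; exact: (HZ _ _ (psiP v)).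
- by apply: Hfun (psiP _) _; left.
Qed.

End FunctionalExtension.

Definition series (F : Type) := nat -> F.

Section Series.
Variable F : comNzRingType.
HB.instance Definition _ := GRing.Zmodule.copy (series F) (nat -> F : Type).
Implicit Types (p q : {poly F}) (a b : series F).

Lemma seriesBE a b n : (a - b) n = a n - b n.
Proof. by []. Qed.

Definition series_scale p a : series F :=
  fun n => \sum_(j < n.+1) p`_j * a (n - j)%N.

(** Coefficients up to [N] see only a truncation of [a], which reduces associativity and the unit
    law to products of polynomials. *)
Lemma series_scale_trunc p a n N : (n <= N)%N ->
  series_scale p a n = (p * \poly_(i < N.+1) a i)`_n.
Proof.
move=> nN; rewrite coefM; apply: eq_bigr => j _; rewrite coef_poly.
by rewrite (leq_ltn_trans (leq_subr _ _)).
Qed.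

Fact series_scaleA p q a :
  series_scale p (series_scale q a) = series_scale (p * q) a.
Proof.
apply/funext => n; rewrite (@series_scale_trunc _ a n n) // -mulrA coefM.
by apply: eq_bigr => j _; rewrite (@series_scale_trunc _ a _ n) ?leq_subr.
Qed.

Fact series_scale1 : left_id 1 series_scale.
Proof.
move=> a; apply/funext => n; rewrite (@series_scale_trunc _ _ _ n) // mul1r.
by rewrite coef_poly ltnSn.
Qed.

Fact series_scaleDr : right_distributive series_scale +%R.
Proof.
move=> p a b; apply/funext => n; rewrite -[RHS]/(_ n + _ n) -big_split.
by apply: eq_bigr => j _ /=; rewrite -mulrDr.
Qed.

Fact series_scaleDl a p q :
  series_scale (p + q) a = series_scale p a + series_scale q a.
Proof.
apply/funext => n; rewrite -[RHS]/(_ n + _ n) -big_split.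
by apply: eq_bigr => j _ /=; rewrite coefD mulrDl.
Qed.

HB.instance Definition _ := GRing.Zmodule_isLmodule.Build {poly F} (series F)
  series_scaleA series_scale1 series_scaleDr series_scaleDl.

Lemma series_scaleE p a n : (p *: a) n = \sum_(j < n.+1) p`_j * a (n - j)%N.
Proof. by []. Qed.

Lemma series_scaleC c a n : (c%:P *: a) n = c * a n.
Proof.
rewrite series_scaleE big_ord_recl /= subn0 coefC /= big1 ?addr0 // => j _.
by rewrite coefC mul0r.
Qed.

Lemma series_scaleX0 a : ('X *: a) 0%N = 0.
Proof. by rewrite series_scaleE big_ord1 coefX mul0r. Qed.

Lemma series_scaleXS a n : ('X *: a) n.+1 = a n.
Proof.
rewrite series_scaleE !big_ord_recl /= coefX mul0r add0r coefX mul1r subSS subn0.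
rewrite big1 ?addr0 // => j _; rewrite coefX mul0r //.
Qed.

End Series.

(** * Lacunary series *)

(* Indicator of the squares of the numbers of 2-adic valuation [k]: for
   distinct [k] these sets are disjoint, and their gaps tend to infinity. *)
Definition lacunary (k n : nat) : bool :=
  [exists m : 'I_n.+1, (n == m * m)%N && (logn 2 m == k)].

Lemma lacunary_sqr k m : lacunary k (m * m) = (logn 2 m == k).
Proof.
apply/existsP/idP => [[j /andP[/eqP mj /eqP <-]]|km].
  by apply/eqP; congr (logn 2 _); nia.
have lem : (m < (m * m).+1)%N by nia.
by exists (Ordinal lem); rewrite /= eqxx.
Qed.

(** The squares next to [m * m] are at distance at least [2m - 1], which exceeds [J], so the window
    of radius [J] contains no other square. *)
Lemma lacunary_gap k m n J : (J < m)%N -> (m * m <= n + J)%N ->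
  (n <= m * m + J)%N -> n != (m * m)%N -> lacunary k n = false.
Proof.
move=> Jm mn nm n_neq; apply/existsP => -[j /andP[/eqP nj _]].
move: mn nm n_neq; rewrite {}nj; case: (ltngtP j m) => [jm|jm|->]; nia.
Qed.

Definition lacunary_series (F : nzRingType) k : series F :=
  fun n => (lacunary k n)%:R.
Definition one_series (F : nzRingType) : series F := fun n => (n == 0)%:R.
Arguments lacunary_series : clear implicits.
Arguments one_series : clear implicits.

Section LacunaryFunctionals.
Variables (F : idomainType) (K : fieldType) (rho : {rmorphism {poly F} -> K}).
Hypothesis rho_inj : forall q, rho q = 0 -> q = 0.

(* [a] looks like the polynomial [q], shifted by [m^2], on longer and longer
   windows centered at the [m^2] with [m] of 2-adic valuation [i]. *)
Definition window_graph i : set (series F * K) := [set z |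
  exists q, z.2 = rho q /\ forall J, exists M, forall m,
    (M <= m)%N -> logn 2 m = i -> forall n,
    (m * m <= n + J)%N -> (n <= m * m + J)%N -> z.1 n = ('X^(m * m) * q)`_n]%classic.

Lemma window_graphP i : semilinear_graph rho (window_graph i).
Proof.
split.
- move=> [a ka] [b kb] [q [/= -> qP]] [q' [/= -> qP']]; exists (q - q').
  split; first by rewrite rmorphB.
  move=> J; have [M MP] := qP J; have [M' MP'] := qP' J; exists (maxn M M') => m.
  rewrite geq_max => /andP[Mm Mm'] mi n n1 n2; rewrite /= seriesBE.
  by rewrite (MP m) // (MP' m) // mulrBr coefB.
- move=> r [a ka] [q [/= -> qP]]; exists (r * q); split; first by rewrite rmorphM.
  (* Coefficient [n] of [r *: a] uses coefficients of [a] at fewer than [size r] places below [n],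
     so a wider window is requested. *)
  move=> J; have [M MP] := qP (J + size r)%N; exists M => m Mm mi n n1 n2.
  rewrite mulrCA coefM /= series_scaleE; apply: eq_bigr => j _.
  have [jr|/(nth_default 0) ->] := ltnP j (size r); last by rewrite !mul0r.
  have := ltn_ord j; rewrite ltnS => jn.
  by rewrite (MP m) //; lia.
- move=> k [q [/= -> qP]]; suff -> : q = 0 by rewrite rmorph0.
  apply/polyP => j; have [M MP] := qP j.
  (* This index has valuation exactly [i] and is at least [M]. Reading the zero series at
     [m * m + j], still inside the window, gives coefficient [j] of [q]. *)
  set m := (2 ^ i * (2 * M).+1)%N.
  have mi : logn 2 m = i.
    rewrite /m lognM ?expn_gt0 // pfactorK // (_ : logn 2 _ = 0)%N ?addn0 //.
    by rewrite lognE dvdn2 /= oddM.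
  have Mm : (M <= m)%N by have : (0 < 2 ^ i)%N by [rewrite expn_gt0]; rewrite /m; nia.
  have := MP m Mm mi (m * m + j)%N; rewrite coefXnM coef0 addKn ltnNge leq_addr /=.
  by move=> <- //; lia.
Qed.

Lemma window_graph_zero i a :
  (forall J, exists M, forall m, (M <= m)%N -> logn 2 m = i -> forall n,
    (m * m <= n + J)%N -> (n <= m * m + J)%N -> a n = 0) ->
  window_graph i (a, 0).
Proof.
move=> a0; exists 0; rewrite rmorph0; split => // J; have [M MP] := a0 J.
by exists M => m Mm mi n n1 n2; rewrite mulr0 coef0 /= (MP m).
Qed.

Lemma window_graph_one i : window_graph i (one_series F, 0).
Proof.
apply: window_graph_zero => J; exists J.+1 => m Jm _ n n1 n2.
by rewrite /one_series; case: eqP => // n0; nia.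
Qed.

Lemma window_graph_lacunary i k : window_graph i (lacunary_series F k, (k == i)%:R).
Proof.
exists (k == i)%:R; rewrite rmorph_nat; split => // J.
exists J.+1 => m Jm mi n n1 n2; rewrite /= /lacunary_series.
have -> : ('X^(m * m) * (k == i)%:R : {poly F})`_n = ((n == m * m) && (k == i))%:R.
  by case: (k == i); rewrite ?mulr1 ?mulr0 ?coefXn ?coef0 ?andbT ?andbF.
have [->|n_neq] := eqVneq n (m * m)%N; first by rewrite lacunary_sqr mi eq_sym.
by rewrite (lacunary_gap k Jm).
Qed.

(** The windows of index [i] eventually show the constant 1 for the [i]-th lacunary series, and 0
    for the other ones and for [one_series]; these values extend to all series. *)
Lemma lacunary_dual i : exists psi : series F -> K,
  [/\ forall u v, psi (u - v) = psi u - psi v,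
      forall q v, psi (q *: v) = rho q * psi v,
      psi (one_series F) = 0
    & forall k, psi (lacunary_series F k) = (k == i)%:R].
Proof.
have [|psi [psiB psiZ psiG]] := semilinear_extension rho_inj (window_graphP i).
  by apply: window_graph_zero => J; exists 0%N.
exists psi; split => //; first exact/psiG/window_graph_one.
by move=> k; apply/psiG/window_graph_lacunary.
Qed.

End LacunaryFunctionals.

(** * Cycles in the completion *)

Section Limits.
Variable L : lieType.
Implicit Types (a b x y : L) (z w : completion L).

Lemma lcs_le m n a : (m <= n)%N -> a \in lcs L n -> a \in lcs L m.
Proof.
move=> /subnK <-; elim: (n - m)%N => // k IHk; rewrite addSn => /lcsS; exact: IHk.
Qed.

(** By induction on [n], the Jacobi identity moves brackets from the second factor to the first. The
    successor comes from the index shift: [[gamma_i, gamma_j]] lies in [gamma_(i+j)] for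
    [i = m + 1], [j = n + 1]. *)
Lemma lcs_lieD m n a b : a \in lcs L m -> b \in lcs L n ->
  lie a b \in lcs L (m + n).+1.
Proof.
elim: n m a b => [|n IHn] m a b La; first by rewrite addn0 => _; apply: lcs_lie.
move=> /zspanP; elim=> {b} [_ [c [d [Lc ->]]]||b c _ Lb _ Lc].
- have -> : lie a (lie c d) = lie (lie a c) d - lie (lie a d) c.
    have /eqP := lie_jacobi a c d; rewrite (lie_antisym d a) lieNl addrAC.
    by rewrite addr_eq0 (lie_antisym (lie c d)) opprK => /eqP ->.
  apply: rpredB; first by rewrite addnS; apply/lcs_lie/IHn.
  by rewrite addnS -addSn; apply: IHn => //; apply: lcs_lie.
- by rewrite lier0 rpred0.
- by rewrite lieBr; apply: rpredB.
Qed.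

Lemma cseq_le z m n a : (m <= n)%N -> lcq_pi n a = z n -> lcq_pi m a = z m.
Proof.
move=> /subnK <-; elim: (n - m)%N => // k IHk; rewrite addSn => E.
by apply: IHk; rewrite -cseqS -E lcq_projE.
Qed.

Lemma completion_limit (s : nat -> L) :
  (forall n, s n.+1 - s n \in lcs L n) ->
  exists z : completion L, forall n, z n = lcq_pi n (s n).
Proof.
move=> sP; suff c : `[< forall n, lcq_proj (lcq_pi n.+1 (s n.+1)) = lcq_pi n (s n) >].
  by exists (Completion c).
by apply/asboolP => n; rewrite lcq_projE; apply/lcq_eqP.
Qed.

Definition cembed a : completion L :=
  Completion (cseq := fun n => lcq_pi n a)
    (introT (asboolP _) (fun n => lcq_projE n a)).

Section TwoElements.
Variables x y : L.

Definition ad_iter n : L := iter n (lie x) y.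

Lemma ad_iter_lcs n : ad_iter n \in lcs L n.
Proof.
by elim: n => // n IHn; rewrite /ad_iter iterS lie_antisym rpredN lcs_lie.
Qed.

(** Put [u_n = ad_iter n]. Applying [[u_(i+1), u_j] = [x, [u_i, u_j]] - [u_i, u_(j+1)]] repeatedly
    ends at a bracket with [y]; [corr_x] and [corr_y] collect what is bracketed with [x] and with
    [y]. Thus [corr_y i j] is [u_(i+j)] with sign [(-1)^i]. *)
Fixpoint corr_x i j : L :=
  if i is k.+1 then lie (ad_iter k) (ad_iter j) - corr_x k j.+1 else 0.
Fixpoint corr_y i j : L :=
  if i is k.+1 then - corr_y k j.+1 else ad_iter j.

Lemma corr_x_lcs i j : corr_x i j \in lcs L (i + j).
Proof.
elim: i j => [|i IHi] j; first exact: rpred0.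
by apply: rpredB; [apply: lcs_lieD; exact: ad_iter_lcs | rewrite addSnnS].
Qed.

Lemma corr_y_lcs i j : corr_y i j \in lcs L (i + j).
Proof.
elim: i j => [|i IHi] j; first exact: ad_iter_lcs.
by rewrite rpredN addSnnS.
Qed.

Lemma lie_ad_iter i j :
  lie (ad_iter i) (ad_iter j) = lie x (corr_x i j) + lie y (corr_y i j).
Proof.
elim: i j => [|i IHi] j /=; first by rewrite lier0 add0r.
have -> : lie (ad_iter i.+1) (ad_iter j) =
    lie x (lie (ad_iter i) (ad_iter j)) - lie (ad_iter i) (ad_iter j.+1).
  rewrite /ad_iter !iterS -!/(ad_iter _); set u := ad_iter i; set v := ad_iter j.
  have /eqP := lie_jacobi x u v; rewrite addrAC addr_eq0 => /eqP E.
  rewrite (lie_antisym x (lie u v)) -E (lie_antisym v x) lieNl.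
  by rewrite (lie_antisym u (lie x v)) opprK subrK.
by rewrite (IHi j.+1) lieBr lieNr opprD addrA.
Qed.

Definition square_sum (c d : nat -> nat) (T : nat -> nat -> L) n : L :=
  \sum_(i < n) \sum_(j < n) T i j *+ (c i * d j).

(** The new terms have [i = n] or [j = n], so sums over growing squares converge. Squares match the
    bracket of two truncated sums exactly, as [lie_ad_sum] shows. *)
Lemma square_sum_lcs c d T n : (forall i j, T i j \in lcs L (i + j)) ->
  square_sum c d T n.+1 - square_sum c d T n \in lcs L n.
Proof.
move=> TP; rewrite /square_sum big_ord_recr /= -addrA addrCA -sumrB.
have TPn i j : (n <= i + j)%N -> T i j *+ (c i * d j) \in lcs L n.
  by move=> ij; apply: rpredMn; apply: lcs_le ij (TP i j).
apply: rpredD.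
  by apply: rpred_sum => j _; apply: TPn; rewrite leq_addr.
apply: rpred_sum => i _; rewrite big_ord_recr /= addrAC subrr add0r.
by apply: TPn; rewrite leq_addl.
Qed.

Definition ad_sum (c : nat -> nat) n : L := \sum_(i < n) ad_iter i *+ c i.

Lemma lie_sumr (I : Type) (r : seq I) a (b : I -> L) :
  lie a (\sum_(i <- r) b i) = \sum_(i <- r) lie a (b i).
Proof. by apply: (big_morph _ (lieDr a)); apply: lier0. Qed.

Lemma lie_suml (I : Type) (r : seq I) (a : I -> L) b :
  lie (\sum_(i <- r) a i) b = \sum_(i <- r) lie (a i) b.
Proof. by apply: (big_morph (fun u => lie u b)) => [u v|]; [apply: lieDl|apply: lie0r]. Qed.

Lemma lieMnr a b n : lie a (b *+ n) = lie a b *+ n.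
Proof. by elim: n => [|n IHn]; rewrite ?mulr0n ?lier0 // !mulrS lieDr IHn. Qed.

Lemma lieMnl a b n : lie (a *+ n) b = lie a b *+ n.
Proof. by elim: n => [|n IHn]; rewrite ?mulr0n ?lie0r // !mulrS lieDl IHn. Qed.

Lemma lie_ad_sum c d n : lie (ad_sum c n) (ad_sum d n) =
  lie x (square_sum c d corr_x n) + lie y (square_sum c d corr_y n).
Proof.
rewrite lie_suml !lie_sumr -big_split; apply: eq_bigr => i _.
rewrite !lie_sumr -big_split; apply: eq_bigr => j _ /=.
by rewrite lieMnl lieMnr -mulrnA mulnC lie_ad_iter mulrnDl !lieMnr.
Qed.

Lemma completion_ad_sum_cycle c d z w :
  (forall n, z n = lcq_pi n (ad_sum c n)) ->
  (forall n, w n = lcq_pi n (ad_sum d n)) ->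
  exists g e, d2 (wedge2 z w - wedge2 (cembed x) g - wedge2 (cembed y) e) = 0.
Proof.
move=> zE wE.
have [g gE] := completion_limit (fun n => square_sum_lcs c d n corr_x_lcs).
have [e eE] := completion_limit (fun n => square_sum_lcs c d n corr_y_lcs).
exists g, e; rewrite !raddfB /= !d2E; apply: completionP => n.
rewrite -[LHS]/(lie (z n) (w n) - lie (lcq_pi n x) (g n) - lie (lcq_pi n y) (e n)).
rewrite zE wE gE eE -!lcq_pi_lie lie_ad_sum raddfD /= addrAC addrK subrr //.
Qed.

End TwoElements.

End Limits.

(** * A map from the completion to power series *)

Section SeriesLie.
Variable F : comNzRingType.

(* Semidirect product: [F] acts on the abelian ideal [series F] through
   multiplication by the variable. *)
Definition series_lie := (F * series F)%type.
HB.instance Definition _ := GRing.Zmodule.on series_lie.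
Implicit Types u v w : series_lie.

Definition series_bracket u v : series_lie :=
  (0, (u.1%:P * 'X) *: v.2 - (v.1%:P * 'X) *: u.2).

Fact series_bracketDl u v w :
  series_bracket (u + v) w = series_bracket u w + series_bracket v w.
Proof.
rewrite /series_bracket; congr pair; first by rewrite /= addr0.
by rewrite /= polyCD mulrDl scalerDl scalerDr opprD addrACA.
Qed.
Fact series_bracketDr u v w :
  series_bracket u (v + w) = series_bracket u v + series_bracket u w.
Proof.
rewrite /series_bracket; congr pair; first by rewrite /= addr0.
by rewrite /= polyCD mulrDl scalerDl scalerDr opprD addrACA.
Qed.
Fact series_bracketxx u : series_bracket u u = 0.
Proof. by rewrite /series_bracket subrr. Qed.
Fact series_bracket_jacobi u v w : series_bracket (series_bracket u v) w +
  series_bracket (series_bracket v w) u + series_bracket (series_bracket w u) v = 0.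
Proof.
rewrite /series_bracket; congr pair; first by rewrite /= !addr0.
rewrite /= !mul0r !scale0r !sub0r !scalerBr !scalerA.
rewrite ![(w.1%:P * 'X * _)]mulrC ![v.1%:P * 'X * (u.1%:P * 'X)]mulrC.
set a := _ *: w.2; set b := _ *: v.2; set c := _ *: u.2.
by rewrite !opprB !addrA !subrK subrr.
Qed.
HB.instance Definition _ := Zmodule_isLie.Build series_lie
  series_bracketDl series_bracketDr series_bracketxx series_bracket_jacobi.

End SeriesLie.

Section CompletionToSeries.
Variables (F : comNzRingType) (L : lieType) (h : L -> series_lie F).
Hypothesis h_morph : is_lie_morphism h.
Implicit Types (a b : L) (z w : completion L).

Let hD a b : h (a + b) = h a + h b. Proof. by case: h_morph. Qed.
Let h_lie a b : h (lie a b) = series_bracket (h a) (h b).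
Proof. by case: h_morph. Qed.
Let h0 : h 0 = 0.
Proof. by apply: (addrI (h 0)); rewrite -hD !addr0. Qed.
Let hB a b : h (a - b) = h a - h b.
Proof. by apply: (addIr (h b)); rewrite -hD !subrK. Qed.

(** A bracket has first component 0 and its second one carries a factor ['X], so each step of the
    lower central series raises the order by one. This continuity lets [h] pass to the
    completion. *)
Lemma lcs_series n a : a \in lcs L n ->
  ((0 < n)%N -> (h a).1 = 0) /\ forall j, (j < n)%N -> (h a).2 j = 0.
Proof.
elim: n a => [|n IHn] a; first by [].
move=> /zspanP; elim=> {a} [_ [a [b [/IHn [a1 a2] ->]]]||a b _ [a1 a2] _ [b1 b2]].
- rewrite h_lie /series_bracket /=; split=> // j jn.
  rewrite -[LHS]/((_ *: _ : series F) j - (_ *: _ : series F) j) -!scalerA.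
  rewrite !series_scaleC; case: j jn => [|j] jn.
    by rewrite !series_scaleX0 !mulr0 subr0.
  by rewrite !series_scaleXS a2 // a1 ?mul0r ?mulr0 ?subr0 //; case: (n) jn.
- by rewrite h0.
- rewrite hB; split=> [n_gt0|j jn]; first by rewrite /= a1 // b1 // subr0.
  by rewrite -[LHS]/((h a).2 j - (h b).2 j) a2 // b2 // subr0.
Qed.

(** By [lcs_series], coefficient [n] is determined modulo [lcs L n.+1], hence the component [n.+1]
    of [z]. *)
Definition cseries z : series F := fun n => (h (lcq_repr (z n.+1))).2 n.
Definition cweight z : F := (h (lcq_repr (z 1))).1.

Lemma cseriesE z a m n : (n < m)%N -> lcq_pi m a = z m -> cseries z n = (h a).2 n.
Proof.
move=> /cseq_le E /E {}E; apply/eqP; rewrite -subr_eq0; apply/eqP.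
have /lcq_eqP/lcs_series[_ /(_ n)] : lcq_pi n.+1 (lcq_repr (z n.+1)) = lcq_pi n.+1 a.
  by rewrite lcq_reprK.
by rewrite hB; apply.
Qed.

Lemma cweightE z a m : (0 < m)%N -> lcq_pi m a = z m -> cweight z = (h a).1.
Proof.
move=> /cseq_le E /E {}E; apply/eqP; rewrite -subr_eq0; apply/eqP.
have /lcq_eqP/lcs_series[] : lcq_pi 1 (lcq_repr (z 1)) = lcq_pi 1 a.
  by rewrite lcq_reprK.
by rewrite hB => /(_ isT).
Qed.

Lemma cseriesB z w : cseries (z - w) = cseries z - cseries w.
Proof.
apply/funext => n; rewrite seriesBE.
rewrite (@cseriesE _ (lcq_repr (z n.+1) - lcq_repr (w n.+1)) n.+1) //.
  by rewrite hB.
by rewrite raddfB /= !lcq_reprK.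
Qed.

Lemma cseries_lie z w : cseries (lie z w) =
  ((cweight z)%:P * 'X) *: cseries w - ((cweight w)%:P * 'X) *: cseries z.
Proof.
apply/funext => n; pose a := lcq_repr (z n.+1); pose b := lcq_repr (w n.+1).
have az : lcq_pi n.+1 a = z n.+1 by apply: lcq_reprK.
have bw : lcq_pi n.+1 b = w n.+1 by apply: lcq_reprK.
rewrite (@cseriesE _ (lie a b) n.+1) //.
rewrite (cweightE _ az) // (cweightE _ bw) // h_lie /series_bracket /= !seriesBE.
rewrite -!scalerA !series_scaleC.
case: n a b az bw => [|n] a b az bw; first by rewrite !series_scaleX0.
by rewrite !series_scaleXS (cseriesE _ az) // (cseriesE _ bw).
Qed.

Variables x y : L.
Hypotheses (hx : h x = (1, 0)) (hy : h y = (0, one_series F)).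

Lemma series_ad_iter n : h (ad_iter x y n) = (0, fun j => (j == n)%:R).
Proof.
elim: n => [|n IHn]; first by rewrite [LHS]hy.
rewrite /ad_iter iterS h_lie -/(ad_iter x y n) IHn hx /series_bracket.
congr pair; apply/funext => -[|j] /=; rewrite scaler0 subr0 mul1r.
  by rewrite series_scaleX0.
by rewrite series_scaleXS eqSS.
Qed.

Lemma series_ad_sum c N n : (n < N)%N -> (h (ad_sum x y c N)).2 n = (c n)%:R.
Proof.
have hMn a k : h (a *+ k) = h a *+ k.
  by elim: k => [|k IHk]; rewrite ?mulr0n // !mulrS hD IHk.
have E : (h (ad_sum x y c N)).2 n = if (n < N)%N then (c n)%:R else 0.
  elim: N => [|N IHN]; rewrite /ad_sum; first by rewrite big_ord0 h0.
  rewrite big_ord_recr /= hD -[LHS]/(_ + _ :> F) IHN.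
  have -> : (h (ad_iter x y N *+ c N)).2 n = (n == N)%:R *+ c N.
    rewrite hMn series_ad_iter; elim: (c N) => [|k IHk] //.
    by rewrite !mulrS -IHk.
  rewrite ltnS; case: ltngtP => [_|_|->]; rewrite ?mul0rn ?addr0 //.
  by rewrite add0r.
by move=> nN; rewrite E nN.
Qed.

Lemma cseries_ad_sum c z : (forall n, z n = lcq_pi n (ad_sum x y c n)) ->
  cseries z = fun n => (c n)%:R.
Proof.
move=> zE; apply/funext => n.
by rewrite (@cseriesE _ (ad_sum x y c n.+1) n.+1) // series_ad_sum.
Qed.

Lemma cseries_x : cseries (cembed x) = 0.
Proof. by apply/funext => n; rewrite (@cseriesE _ x n.+1) // hx. Qed.

Lemma cseries_y : cseries (cembed y) = one_series F.
Proof. by apply/funext => n; rewrite (@cseriesE _ y n.+1) // hy. Qed.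

End CompletionToSeries.

(** * Alternating forms on the exterior square *)

Lemma ext2_sum_wedge (V : zmodType) (t : ext2 V) :
  exists s : seq (V * V), t = \sum_(p <- s) wedge2 p.1 p.2.
Proof.
elim/presented_ind: t => [[a b]||t u [s ->] [s' ->]].
- by exists [:: (a, b)]; rewrite big_seq1.
- by exists [::]; rewrite big_nil.
- exists (s ++ [seq (- p.1, p.2) | p <- s']); rewrite big_cat big_map /=.
  by congr (_ + _); rewrite -sumrN; apply: eq_bigr => p _; rewrite wedge2Nl.
Qed.

(** Because the multipliers [c] and [- c] are opposite, [e u] meets the symmetric expression
    [phi v * phi' w + phi w * phi' v] in the value on [d3 (wedge3 u v w)]. It occurs twice, from
    [lie u v] and from [lie w u], with opposite signs. *)
Lemma wedge_form_exists (L : lieType) (K : comNzRingType)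
    (phi phi' e : L -> K) (c : K) :
  (forall u v, phi (u - v) = phi u - phi v) ->
  (forall u v, phi' (u - v) = phi' u - phi' v) ->
  (forall u v, phi (lie u v) = c * (e u * phi v - e v * phi u)) ->
  (forall u v, phi' (lie u v) = - c * (e u * phi' v - e v * phi' u)) ->
  exists W : {additive ext2 L -> K},
    (forall a b, W (wedge2 a b) = phi a * phi' b - phi b * phi' a) /\
    (forall t, W (d3 t) = 0).
Proof.
move=> phiB phiB' phi_lie phi_lie'.
have phiD u v : phi (u + v) = phi u + phi v.
  by apply/eqP; rewrite -subr_eq -phiB addrK.
have phiD' u v : phi' (u + v) = phi' u + phi' v.
  by apply/eqP; rewrite -subr_eq -phiB' addrK.
pose f (p : L * L) := phi p.1 * phi' p.2 - phi p.2 * phi' p.1.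
have f_rel D : ext2_rel D -> free_lift f D = 0.
  case=> [a a' b|a b b'|a]; rewrite ?raddfB /= ?free_liftU /f /= ?phiD ?phiD';
    by ring.
pose W : {additive ext2 L -> K} := HB.pack (presented_lift f : ext2 L -> K)
  (GRing.isZmodMorphism.Build (ext2 L) K _ (presented_lift_is_zmod_morphism f_rel)).
have WE a b : W (wedge2 a b) = phi a * phi' b - phi b * phi' a.
  exact: presented_lift_gen f_rel _.
exists W; split => // t; elim/presented_ind: t => [[[u v] w]||t t' Ht Ht'].
- rewrite -/(wedge3 u v w) d3E !raddfD !WE !phi_lie !phi_lie'.
  by ring.
- by rewrite !raddf0.
- by rewrite !raddfB Ht Ht' subr0.
Qed.

Lemma mxrank_mul_le (K : fieldType) m r n (A : 'M[K]_(m, r)) (B : 'M[K]_(r, n)) :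
  (\rank (A *m B) <= r)%N.
Proof. exact: leq_trans (mxrankM_maxr _ _) (rank_leq_row _). Qed.

(** * Rational functions and the sign change of the variable *)

Section FractionField.
Variable F : fieldType.
Let K := {fraction {poly F}}.

(** Semilinearity along this map produces the multiplier [- c] that [wedge_form_exists] asks of
    [phi']. *)
Definition frac_subst_opp : {rmorphism {poly F} -> K} :=
  (@tofrac {poly F} \o comp_poly (- 'X : {poly F}))%FUN.

Lemma frac_subst_opp_inj q : frac_subst_opp q = 0 -> q = 0.
Proof.
move=> /eqP; rewrite tofrac_eq0 comp_poly_eq0 ?size_polyN ?size_polyX //.
by move=> /eqP.
Qed.

Lemma tofrac_inj0 (q : {poly F}) : tofrac q = 0 -> q = 0.
Proof. by move=> /eqP; rewrite tofrac_eq0 => /eqP. Qed.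

Lemma frac_subst_oppCX (a : F) :
  tofrac ((a%:P * 'X) \Po (- 'X)) = - tofrac (a%:P * 'X) :> K.
Proof. by rewrite comp_polyM comp_polyC comp_polyX mulrN tofracN. Qed.

Lemma fraction_pchar p : p \in [pchar F] -> p%:R = 0 :> K.
Proof.
move=> Fp; rewrite -(rmorph_nat (@tofrac {poly F})) -(rmorph_nat (@polyC F)).
by rewrite (pcharf0 Fp) !rmorph0.
Qed.

End FractionField.

(** * Homology classes and the rank bound *)

Section HomologyClasses.
Variable L : lieType.

Definition H2_class (z : Z2 L) : H2 L := \pi_(Quotient.quot (@boundary2 L)) z.
Fact H2_class_is_zmod_morphism : zmod_morphism H2_class.
Proof. by move=> z w; rewrite /H2_class !piE. Qed.
HB.instance Definition _ := GRing.isZmodMorphism.Build (Z2 L) (H2 L)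
  H2_class H2_class_is_zmod_morphism.

Lemma H2_class_surj x : exists z, H2_class z = x.
Proof. by exists (repr (x : Quotient.quot (@boundary2 L))); apply: reprK. Qed.

Lemma H2_class_eq z w : H2_class z = H2_class w ->
  exists t, d3 t = val z - val w.
Proof. by move=> /eqP; rewrite -Quotient.idealrBE => /asboolP. Qed.

End HomologyClasses.

Lemma lacunary_cycles_rank (L : lieType) (x y : L)
    (h : forall F : fieldType, L -> series_lie F)
    (tau : nat -> Z2 (completion L)) :
  (forall F : fieldType, [/\ is_lie_morphism (h F), h F x = (1, 0)
     & h F y = (0, one_series F)]) ->
  (forall k, exists (z w g e : completion L),
    [/\ forall n, z n = lcq_pi n (ad_sum x y (lacunary k.*2) n),
        forall n, w n = lcq_pi n (ad_sum x y (lacunary k.*2.+1) n)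
      & val (tau k) = wedge2 z w - wedge2 (cembed x) g - wedge2 (cembed y) e]) ->
  forall (s : seq (completion L * completion L)) (p : nat)
    (eta : ext2 (completion L)) t,
  prime p ->
  \sum_(q <- s) wedge2 q.1 q.2 = \sum_(k < p) val (tau k) + eta *+ p + d3 t ->
  (p <= size s + size s)%N.
Proof.
move=> hP tauP s p eta t p_pr; pose F : fieldType := 'F_p.
pose K : fieldType := {fraction {poly F}}.
have [h_morph hx hy] := hP F.
have psi1 (i : nat) := cid (lacunary_dual (@tofrac_inj0 F) i).
have psi2 (i : nat) := cid (lacunary_dual (@frac_subst_opp_inj F) i).
pose phi i z := projT1 (psi1 i) (cseries (h F) z) : K.
pose phi' i z := projT1 (psi2 i) (cseries (h F) z) : K.
have phiB i u v : phi i (u - v) = phi i u - phi i v.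
  by rewrite /phi cseriesB //; case: (psi1 i) => /= psi [].
have phiB' i u v : phi' i (u - v) = phi' i u - phi' i v.
  by rewrite /phi' cseriesB //; case: (psi2 i) => /= psi [].
pose e z : K := tofrac (cweight (h F) z)%:P.
pose c : K := tofrac 'X.
have phi_lie i u v : phi i (lie u v) = c * (e u * phi i v - e v * phi i u).
  rewrite /phi cseries_lie //; case: (psi1 i) => /= psi [psiB psiZ _ _].
  by rewrite psiB !psiZ /= !tofracM -/c -!/(e _); ring.
have phi_lie' i u v : phi' i (lie u v) = - c * (e u * phi' i v - e v * phi' i u).
  rewrite /phi' cseries_lie //; case: (psi2 i) => /= psi [psiB psiZ _ _].
  by rewrite psiB !psiZ /= !frac_subst_oppCX !tofracM -/c -!/(e _); ring.
have phi_x i : phi i (cembed x) = 0.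
  rewrite /phi (cseries_x h_morph hx); case: (psi1 i) => /= psi [psiB _ _ _].
  by rewrite -[X in psi X](subrr 0) psiB subrr.
have phi_x' i : phi' i (cembed x) = 0.
  rewrite /phi' (cseries_x h_morph hx); case: (psi2 i) => /= psi [psiB _ _ _].
  by rewrite -[X in psi X](subrr 0) psiB subrr.
have phi_y i : phi i (cembed y) = 0.
  by rewrite /phi (cseries_y h_morph hy); case: (psi1 i) => /= psi [].
have phi_y' i : phi' i (cembed y) = 0.
  by rewrite /phi' (cseries_y h_morph hy); case: (psi2 i) => /= psi [].
have phi_lac i k (z : completion L) :
    (forall n, z n = lcq_pi n (ad_sum x y (lacunary k) n)) ->
    phi i z = (k == i)%:R.
  move=> /(cseries_ad_sum h_morph hx hy); rewrite /phi => ->.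
  by case: (psi1 i) => /= psi [_ _ _ psi_lac]; apply: psi_lac.
have phi_lac' i k (z : completion L) :
    (forall n, z n = lcq_pi n (ad_sum x y (lacunary k) n)) ->
    phi' i z = (k == i)%:R.
  move=> /(cseries_ad_sum h_morph hx hy); rewrite /phi' => ->.
  by case: (psi2 i) => /= psi [_ _ _ psi_lac]; apply: psi_lac.
have WP i j := cid (wedge_form_exists (phiB i) (phiB' j) (phi_lie i) (phi_lie' j)).
pose W i j := projT1 (WP i.*2 j.*2.+1).
have WE i j a b : W i j (wedge2 a b) =
    phi i.*2 a * phi' j.*2.+1 b - phi i.*2 b * phi' j.*2.+1 a.
  by rewrite /W; case: (WP _ _) => /= w [].
have Wd3 i j u : W i j (d3 u) = 0 by rewrite /W; case: (WP _ _) => /= w [].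
have Wtau i j k : W i j (val (tau k)) = ((k == i) && (k == j))%:R.
  have [z [w [g [d [zE wE ->]]]]] := tauP k.
  rewrite !raddfB /= !WE !phi_x !phi_x' !phi_y !phi_y' !(mul0r, mulr0, subr0).
  rewrite (phi_lac _ _ _ zE) (phi_lac _ _ _ wE).
  rewrite (phi_lac' _ _ _ zE) (phi_lac' _ _ _ wE).
  (* Even and odd indices never meet, so only the first of the two products in the form survives. *)
  rewrite (_ : (k.*2.+1 == i.*2) = false) ?mul0r ?subr0; last by lia.
  rewrite (_ : (k.*2 == i.*2) = (k == i)); last by lia.
  rewrite (_ : (k.*2.+1 == j.*2.+1) = (k == j)); last by lia.
  by rewrite -natrM mulnb.
move=> sE; have pK : p%:R = 0 :> K := fraction_pchar (pchar_Fp p_pr).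
have Ws i j : (i < p)%N -> \sum_(q <- s)
    (phi i.*2 q.1 * phi' j.*2.+1 q.2 - phi i.*2 q.2 * phi' j.*2.+1 q.1) = (i == j)%:R.
  move=> ip; have := congr1 (W i j) sE; rewrite !raddfD raddfMn /= Wd3 addr0.
  rewrite -[_ *+ p]mulr_natr pK mulr0 addr0 !raddf_sum.
  rewrite (eq_bigr _ (fun q _ => WE i j q.1 q.2)) => ->.
  rewrite (eq_bigr _ (fun (k : 'I_p) _ => Wtau i j k)).
  rewrite (bigD1 (Ordinal ip)) //= eqxx /= big1 ?addr0 // => k.
  by rewrite -val_eqE /= => /negPf ->.
pose q l := nth (0, 0) s l.
pose A : 'M[K]_(p, size s) := \matrix_(i, l) phi i.*2 (q l).1.
pose B : 'M[K]_(size s, p) := \matrix_(l, j) phi' j.*2.+1 (q l).2.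
pose C : 'M[K]_(p, size s) := \matrix_(i, l) phi i.*2 (q l).2.
pose D : 'M[K]_(size s, p) := \matrix_(l, j) phi' j.*2.+1 (q l).1.
have ABCD : 1%:M = A *m B - C *m D.
  apply/matrixP => i j; rewrite !mxE -[RHS]sumrB.
  rewrite -val_eqE -(Ws i j) // (big_nth (0, 0)) big_mkord.
  by apply: eq_bigr => l _; rewrite !mxE.
rewrite -{1}(mxrank1 K p) ABCD (leq_trans (mxrank_add _ _)) // mxrank_opp.
by rewrite leq_add ?mxrank_mul_le.
Qed.

Theorem mainTheorem3 (X : Type) (f : lieType) (i : X -> f)
  (f_free : is_free_lie i) (two_generators : exists x y : X, x <> y) :
  ~ cotorsion (H2 (completion f)).
Proof.
move=> cH2; have [x [y xy]] := two_generators.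
have hP (F : fieldType) : exists h : f -> series_lie F,
    [/\ is_lie_morphism h, h (i x) = (1, 0) & h (i y) = (0, one_series F)].
  have [h [[h_morph hi] _]] := f_free (series_lie F) (fun z =>
    if `[< z = x >] then (1, 0) else if `[< z = y >] then (0, one_series F) else 0).
  exists h; rewrite !hi; split => //; first by rewrite asboolT.
  by rewrite asboolF ?asboolT // => /esym.
have alphaP k : exists z : completion f,
    forall n, z n = lcq_pi n (ad_sum (i x) (i y) (lacunary k) n).
  apply: completion_limit => n; rewrite /ad_sum big_ord_recr /= addrAC subrr add0r.
  exact/rpredMn/ad_iter_lcs.
have /boolp.choice[tau tauP] : forall k : nat, exists c : Z2 (completion f),
    exists (z w g e : completion f),
    [/\ forall n, z n = lcq_pi n (ad_sum (i x) (i y) (lacunary k.*2) n),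
        forall n, w n = lcq_pi n (ad_sum (i x) (i y) (lacunary k.*2.+1) n)
      & val c = wedge2 z w - wedge2 (cembed (i x)) g - wedge2 (cembed (i y)) e].
  move=> k; have [z zE] := alphaP k.*2; have [w wE] := alphaP k.*2.+1.
  have [g [e /eqP gE]] := completion_ad_sum_cycle zE wE.
  by exists (MkZ2 gE), z, w, g, e.
have [xi xiP] :=
  cotorsion_simultaneous_congruence (fun p => \sum_(k < p) H2_class (tau k)) cH2.
have [zeta zetaE] := H2_class_surj xi.
have [s sE] := ext2_sum_wedge (val zeta).
(* The length of [s] depends on [xi] alone, so [p] can now be chosen beyond the rank bound. *)
have [p p_big p_pr] := prime_above (size s + size s).
have [eta xiE] := xiP p p_pr; have [eta' etaE] := H2_class_surj eta.
have [t tE] : exists t, d3 t = val zeta - val (\sum_(k < p) tau k + eta' *+ p).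
  by apply: H2_class_eq; rewrite zetaE xiE -etaE raddfD raddfMn raddf_sum.
have := @lacunary_cycles_rank _ _ _ _ tau (fun F => projT2 (cid (hP F))) tauP
  s p (val eta') t p_pr.
rewrite leqNgt p_big => /(_ _)/negP; apply => //.
have valE : val (\sum_(k < p) tau k + eta' *+ p) =
    \sum_(k < p) val (tau k) + val eta' *+ p by rewrite raddfD raddfMn raddf_sum.
by rewrite -sE tE valE addrC subrK.
Qed.
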